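(* Let $\alpha\ge1$ and suppose $\mathcal{M}_0$ is a universally truthful mechanism for digital goods auctions without externalities that is $\alpha$-competitive with respect to $\mathcal{F}^{(2)}$. Then there exists a universally truthful mechanism for markets with additive valuations that is $2(1+\alpha)$-competitive with respect to $\mathcal{F}^{(2)}$, i.e. its expected revenue is at least $\mathcal{F}^{(2)}(t)/(2(1+\alpha))$ for every type vector $t$.
   Context: Digital goods auction without externalities: $n\ge2$ agents, unlimited supply, agent $i$ has private value $t_i\ge0$ for one copy (value $0$ otherwise); a mechanism selects winners and prices (losers pay $0$); utility is value minus price for winners, $0$ for losers. A deterministic mechanism is truthful if reporting the true type maximizes each agent's utility for every fixed reports of the others, and truthful agents have nonnegative utility; universally truthful means a probability distribution over deterministic truthful mechanisms. There $\mathcal{F}^{(2)}(t)=\max\{c|S|: c\ge0,\ |S|\ge2,\ t_i\ge c\ \forall i\in S\}$, and $\alpha$-competitive means expected revenue $\ge \mathcal{F}^{(2)}(t)/\alpha$ for all $t$. Market with additive valuations: same agents and supply, but agent $i$'s value for winning set $S\ni i$ is $v_i(t_i,S)=t_i+w_i(S)$ (and $0$ if $i\notin S$), where $t_i\ge0$ is private and $w_i\ge0$ is publicly known, each $v_i(t_i,\cdot)$ being monotone ($v_i(t_i,S)\le v_i(t_i,R)$ for $S\subseteq R$) and subadditive ($v_i(t_i,S\cup R)\le v_i(t_i,S)+v_i(t_i,R)$ for $i\in S\cap R$). Truthfulness is defined analogously with these valuations, and here $\mathcal{F}^{(2)}(t)=\max\{c|S| : c\ge0,\ S\subseteq[n],\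 |S|\ge2,\ v_i(t_i,S)\ge c\ \forall i\in S\}$. *)

(* Defs.v *)
From HB Require Import structures.
From mathcomp Require Import all_boot all_order all_algebra.
From mathcomp Require Import all_classical all_reals all_analysis.
Set Implicit Arguments. Unset Strict Implicit. Unset Printing Implicit Defensive.
Import Order.TTheory GRing.Theory Num.Theory.
Local Open Scope ring_scope.

Section Mech.
Variables (R : realType) (n : nat).

(* A deterministic mechanism: given the reported type vector b, selects a set
   of winners and a price for each agent; only winners pay (losers pay 0). *)
Definition mech := ('I_n -> R) -> {set 'I_n} * ('I_n -> R).

Definition winners (m : mech) (b : 'I_n -> R) : {set 'I_n} := (m b).1.

Definition payment (m : mech) (b : 'I_n -> R) (i : 'I_n) : R :=
  if i \in winners m b then (m b).2 i else 0.

Definition revenue (m : mech) (b : 'I_n -> R) : R :=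
  \sum_(i < n) payment m b i.

(* A valuation model: val i ti S is the value of agent i with (private) type
   ti for the winning set S, when i \in S (value 0 if i \notin S). *)
Definition valuation := 'I_n -> R -> {set 'I_n} -> R.

Definition utility (val : valuation) (m : mech) (b : 'I_n -> R)
    (i : 'I_n) (ti : R) : R :=
  if i \in winners m b then val i ti (winners m b) - (m b).2 i else 0.

Definition upd (b : 'I_n -> R) (i : 'I_n) (x : R) : 'I_n -> R :=
  fun j => if j == i then x else b j.

Definition truthful (val : valuation) (m : mech) : Prop :=
  forall (b : 'I_n -> R), (forall j, 0 <= b j) ->
  forall (i : 'I_n) (ti x : R), 0 <= ti -> 0 <= x ->
    utility val m (upd b i x) i ti <= utility val m (upd b i ti) i ti /\
    0 <= utility val m (upd b i ti) i ti.

(* A universally truthful mechanism: a probability distribution P over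
   deterministic truthful mechanisms M w (w drawn from P); the revenue is
   required to be measurable in w so that its expectation makes sense. *)
Definition univ_truthful d (T : measurableType d) (P : probability T R)
    (val : valuation) (M : T -> mech) : Prop :=
  (forall w, truthful val (M w)) /\
  (forall t : 'I_n -> R, measurable_fun setT (fun w => revenue (M w) t)).

Definition exp_revenue d (T : measurableType d) (P : probability T R)
    (M : T -> mech) (t : 'I_n -> R) : \bar R :=
  (\int[P]_w (revenue (M w) t)%:E)%E.

(* F^(2): max { c |S| : c >= 0, |S| >= 2, v_i(t_i,S) >= c for all i in S },
   written as the supremum of that (finite, attained) set. *)
Definition F2 (val : valuation) (t : 'I_n -> R) : R :=
  sup [set x : R | exists (c : R) (S : {set 'I_n}),
        [/\ 0 <= c, (1 < #|S|)%N, (forall i, i \in S -> c <= val i (t i) S)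
          & x = c * (#|S|)%:R]].

Definition val_dg : valuation := fun i ti S => ti.

Definition val_add (w : 'I_n -> {set 'I_n} -> R) : valuation :=
  fun i ti S => ti + w i S.

Definition vfull (val : valuation) (i : 'I_n) (ti : R) (S : {set 'I_n}) : R :=
  if i \in S then val i ti S else 0.

Definition alpha_competitive d (T : measurableType d) (P : probability T R)
    (val : valuation) (M : T -> mech) (alpha : R) : Prop :=
  forall t : 'I_n -> R, (forall i, 0 <= t i) ->
    ((F2 val t / alpha)%:E <= exp_revenue P M t)%E.

End Mech.

(* Main.v *)
Require Import Defs.
From HB Require Import structures.
From mathcomp Require Import all_boot all_order all_algebra.
From mathcomp Require Import all_classical all_reals all_analysis.
From mathcomp Require Import lra.
From mathcomp Require Import measurable_realfun.
Import Order.TTheory GRing.Theory Num.Theory.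
Import numFieldNormedType.Exports.
Local Open Scope ring_scope.
Set Implicit Arguments. Unset Strict Implicit. Unset Printing Implicit Defensive.

(** Truthful mechanisms with additive valuations are exactly the truthful
    digital goods mechanisms in which every winner [i] of the winning set [S]
    pays [w i S] on top of its critical price.  Mix two of them: with
    probability [1 / (1 + alpha)] everybody wins at critical price [0], which
    earns [W], the sum of the [w i [n]]; otherwise run [M0], which earns at
    least [F2_dg / alpha].  The expected revenue is at least
    [(F2_dg + W) / (1 + alpha)], and [F2_add <= 2 (F2_dg + W)], because every
    member of an optimal set has either [t i >= c / 2] or [w i [n] >= c / 2].

    Only the revenue of [M0] is known to be measurable, not its winning set, so
    the surcharges need not be measurable.  But the expected revenue depends
    only on the probability [G i b x] that [i] wins with report [x] against
    [b].  Extend the expectation to a positive linear functional on all bounded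
    functions (Hahn-Banach), define [G] with it, and realise [G] again by
    letting [i] win when a uniform [u] in [0, 1] satisfies [u < G i b x].
    Comparing Riemann sums of the payments shows that no revenue is lost. *)

(** * Hahn-Banach domination through Zorn's lemma *)

Section HahnBanach.
Local Open Scope classical_set_scope.
Local Open Scope ring_scope.
Variables (R : realType) (V : lmodType R).
Implicit Types (p q : V -> R) (f g : V).

Definition sublinear p : Prop :=
  (forall f g, p (f + g) <= p f + p g) /\
  (forall c f, 0 <= c -> p (c *: f) <= c * p f).

Lemma sublinear0 p : sublinear p -> p 0 = 0.
Proof.
move=> [pD pZ]; have := pD 0 0; have := pZ 0 0 (lexx _).
by rewrite scale0r addr0; lra.
Qed.

Lemma sublinearZ p c f : sublinear p -> 0 <= c -> p (c *: f) = c * p f.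
Proof.
move=> sp; rewrite le_eqVlt => /predU1P[<-|c0].
  by rewrite scale0r mul0r sublinear0.
apply/eqP; rewrite eq_le (sp.2 _ _ (ltW c0)) /=.
have := sp.2 c^-1 (c *: f); rewrite invr_ge0 ltW// => /(_ isT).
by rewrite scalerA mulVf ?lt0r_neq0// scale1r ler_pdivlMl.
Qed.

Lemma sublinearN p f : sublinear p -> - p (- f) <= p f.
Proof.
by move=> sp; have := sp.1 f (- f); rewrite subrr sublinear0//; lra.
Qed.

Section Tilt.
Variables (p : V -> R) (g : V).
Hypothesis sp : sublinear p.

Let vals f := [set x : R | exists2 s : R, 0 <= s & x = p (f + s *: g) - s * p g].

(** This is the greatest sublinear functional below [p] whose value at [- g] is at most [- p g]. *)
Definition tilt f : R := inf (vals f).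

Let vals_lb f : lbound (vals f) (- p (- f)).
Proof.
move=> _ [s s0 ->]; have := sp.1 (f + s *: g) (- f).
by rewrite addrAC subrr add0r sublinearZ//; lra.
Qed.

Let tilt_le f s : 0 <= s -> tilt f <= p (f + s *: g) - s * p g.
Proof. by move=> s0; apply: ge_inf; [exists (- p (- f))|exists s]. Qed.

Let tilt_has_inf f : has_inf (vals f).
Proof.
split; last by exists (- p (- f)).
by exists (p (f + 0 *: g) - 0 * p g); exists 0.
Qed.

Lemma tilt_le_base f : tilt f <= p f.
Proof. by have := @tilt_le f 0 (lexx _); rewrite scale0r addr0 mul0r subr0. Qed.

Lemma tilt_opp : tilt (- g) <= - p g.
Proof.
have := @tilt_le (- g) 1 ler01.
by rewrite scale1r mul1r addNr sublinear0// add0r.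
Qed.

Lemma tilt_sublinear : sublinear tilt.
Proof.
split=> [f h|c f].
  apply/ler_addgt0Pr => e e0.
  have e2 : 0 < e / 2 by lra.
  have [_ [s s0 ->] sl] := inf_adherent e2 (tilt_has_inf f).
  have [_ [r r0 ->] rl] := inf_adherent e2 (tilt_has_inf h).
  have := @tilt_le (f + h) (s + r) (addr_ge0 s0 r0).
  have := sp.1 (f + s *: g) (h + r *: g).
  by rewrite addrACA -scalerDl mulrDl; move: sl rl; rewrite -/(tilt f) -/(tilt h); lra.
rewrite le_eqVlt => /predU1P[<-|c0].
  by rewrite scale0r mul0r (le_trans (tilt_le_base _))// sublinear0.
rewrite mulrC -ler_pdivrMr//; apply: lb_le_inf.
  by have [] := tilt_has_inf f.
move=> _ [s s0 ->]; rewrite ler_pdivrMr//.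
have := @tilt_le (c *: f) (c * s) (mulr_ge0 (ltW c0) s0).
by rewrite -scalerA -scalerDr (sublinearZ _ sp (ltW c0)); lra.
Qed.

End Tilt.

(* A minimal sublinear functional [q] satisfies [q (- g) <= - q g], since its
   tilt in the direction [g] is a sublinear functional below it. *)
Lemma sublinear_dominates_linear p : sublinear p ->
  exists L : {scalar V}, forall f, L f <= p f.
Proof.
move=> sp.
pose T := {q : V -> R | sublinear q /\ forall f, q f <= p f}.
pose t0 : T := exist _ p (conj sp (fun=> lexx _)).
(* The order is reversed, so that a maximal element for Zorn's lemma is a minimal functional; a
   nonempty chain is bounded by its pointwise infimum. *)
pose le (q r : T) := `[< forall f, sval r f <= sval q f >].
have [||A Atot|[q [sq qp]] qmin] := @ZL_preorder T t0 le.
- by move=> q; apply/asboolP.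
- move=> q r s /asboolP qr /asboolP rs; apply/asboolP => f.
  exact: le_trans (rs f) (qr f).
- have [[a Aa]|A0] := pselect (A !=set0)%classic; last first.
    by exists t0 => s As; exfalso; apply: A0; exists s.
  pose vals f := [set x : R | exists2 q : T, A q & x = sval q f].
  have valsP f : has_inf (vals f).
    split; first by exists (sval a f), a.
    exists (- p (- f)) => _ [[q [sq qp]] _ ->] /=.
    by have := sublinearN f sq; have := qp (- f); lra.
  have m_le f (q : T) : A q -> inf (vals f) <= sval q f.
    by move=> Aq; apply: ge_inf; [exact: (valsP f).2|exists q].
  have sm : sublinear (fun f => inf (vals f)).
    split=> [f g|c f c0].
      apply/ler_addgt0Pr => e e0.
      have e2 : 0 < e / 2 by lra.
      have [_ [q Aq ->] ql] := inf_adherent e2 (valsP f).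
      have [_ [r Ar ->] rl] := inf_adherent e2 (valsP g).
      (* Near-minimisers at [f] and at [g] are comparable in the chain, so the smaller functional
         serves both arguments. *)
      have [/asboolP qr|/asboolP rq] := Atot _ _ Aq Ar.
        have := m_le (f + g) r Ar; have := (svalP r).1.1 f g.
        by have := qr f; lra.
      have := m_le (f + g) q Aq; have := (svalP q).1.1 f g.
      by have := rq g; lra.
    move: c0; rewrite le_eqVlt => /predU1P[<-|c0].
      by rewrite scale0r mul0r (le_trans (m_le _ _ Aa))// sublinear0//;
        have [] := svalP a.
    rewrite mulrC -ler_pdivrMr//; apply: lb_le_inf; first exact: (valsP f).1.
    move=> _ [q Aq ->]; rewrite ler_pdivrMr// mulrC.
    by rewrite -(sublinearZ _ (svalP q).1 (ltW c0)) m_le.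
  have mp f : inf (vals f) <= p f.
    exact: le_trans (m_le f _ Aa) ((svalP a).2 f).
  exists (exist _ (fun f => inf (vals f)) (conj sm mp)) => q Aq.
  by apply/asboolP => f /=; exact: m_le.
have qN f : q (- f) = - q f.
  have tp g : tilt q f g <= p g by apply: le_trans (qp g); exact: tilt_le_base.
  have := qmin (exist _ (tilt q f) (conj (tilt_sublinear f sq) tp)).
  have /asboolP h : `[< forall g, tilt q f g <= q g >].
    by apply/asboolP => g; exact: tilt_le_base.
  move=> /(_ (asboolT h))/asboolP/(_ (- f))/= qt.
  have := tilt_opp f sq; have := sublinearN f sq; lra.
have qD f g : q (f + g) = q f + q g.
  (* Oddness turns subadditivity at [- f] and [- g] into superadditivity at [f] and [g]. *)
  have := sq.1 f g; have := sq.1 (- f) (- g).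
  by rewrite -opprD !qN; lra.
have qZ c f : q (c *: f) = c * q f.
  have [c0|/ltW c0] := leP 0 c; first exact: sublinearZ.
  rewrite -[c]opprK scaleNr qN sublinearZ ?mulNr// oppr_ge0//.
have qlin : linear_for *%R q by move=> c f g; rewrite qD qZ.
by exists (HB.pack_for {scalar V} q (GRing.isLinear.Build _ _ _ _ _ qlin)).
Qed.

End HahnBanach.

(** * The vector space of all bounded functions, measurable or not *)

Section BoundedFunctions.
Local Open Scope classical_set_scope.
Local Open Scope ring_scope.
Variables (T : Type) (R : realType).

Definition bfun_pred : {pred T -> R} :=
  mem [set f : T -> R | exists M : R, forall x, `|f x| <= M].

Record bfun := BFun { bfun_val :> T -> R; _ : bfun_val \in bfun_pred }.

HB.instance Definition _ := [isSub for bfun_val].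
HB.instance Definition _ := [Choice of bfun by <:].

Lemma bfun_submod_closed : submod_closed bfun_pred.
Proof.
split=> [|a f g]; rewrite !inE.
  by exists 0 => x; rewrite normr0.
move=> [M fM] [N gN]; exists (`|a| * M + N) => x.
rewrite (le_trans (ler_normD _ _))// lerD//.
by rewrite [leLHS]normrZ ler_wpM2l.
Qed.

HB.instance Definition _ := GRing.isSubmodClosed.Build _ _ bfun_pred
  bfun_submod_closed.
HB.instance Definition _ := [SubChoice_isSubLmodule of bfun by <:].

Lemma bfunP (f : bfun) : exists M : R, forall x, `|f x| <= M.
Proof. by have := valP f; rewrite inE. Qed.

Lemma bfunDE (f g : bfun) x : (f + g) x = f x + g x.
Proof. by []. Qed.

Lemma bfunNE (f : bfun) x : (- f) x = - f x.
Proof. by []. Qed.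

Lemma bfunZE a (f : bfun) x : (a *: f) x = a * f x.
Proof. by []. Qed.

Lemma bfun_sumE I (r : seq I) (F : I -> bfun) x :
  (\sum_(i <- r) F i) x = \sum_(i <- r) F i x.
Proof. by elim/big_rec2: _ => // i y f _ <-. Qed.

Lemma bool_bfun_pred (A : T -> bool) : (fun x => (A x)%:R) \in bfun_pred.
Proof. by rewrite inE; exists 1 => x; case: (A x); rewrite ?normr1 ?normr0. Qed.

Definition bool_bfun (A : T -> bool) : bfun := BFun (bool_bfun_pred A).

End BoundedFunctions.

(** * Extending the expectation to all bounded functions *)

Section Mean.
Local Open Scope classical_set_scope.
Local Open Scope ring_scope.
Variables (d : measure_display) (T : measurableType d) (R : realType).
Variable P : probability T R.

Definition measurable_bounded (g : T -> R) : Prop :=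
  measurable_fun setT g /\ exists M : R, forall x, `|g x| <= M.

Lemma measurable_bounded_cst (c : R) : measurable_bounded (fun=> c).
Proof. by split; [exact: measurable_cst|exists `|c|]. Qed.

Lemma integrable_measurable_bounded g :
  measurable_bounded g -> P.-integrable setT (EFin \o g).
Proof.
move=> [mg [M gM]]; apply: measurable_bounded_integrable => //.
  by rewrite (le_lt_trans (probability_le1 _ _))// ltry.
by exists M; split; [exact: num_real|move=> N MN x _; exact: le_trans (gM x) (ltW MN)].
Qed.

Lemma Rintegral_prob_cst (c : R) : \int[P]_(x in setT) c = c.
Proof.
rewrite Rintegral_cst// -[RHS]mulr1; congr (_ * _).
by have /(congr1 (@fine R))/= := probability_setT P.
Qed.

(** A linear functional below this upper integral is positive, and it agrees with the integral on
    bounded measurable functions. *)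
Definition upper_integral (f : bfun T R) : R :=
  inf [set r : R | exists2 g, measurable_bounded g /\ (forall x, f x <= g x)
                            & r = \int[P]_(x in setT) g x].

Let upper_has_inf (f : bfun T R) :
  has_inf [set r : R | exists2 g, measurable_bounded g /\ (forall x, f x <= g x)
                                & r = \int[P]_(x in setT) g x].
Proof.
have [M fM] := bfunP f; split.
  exists (\int[P]_(x in setT) M), (fun=> M) => //.
  split=> [|x]; first exact: measurable_bounded_cst.
  by rewrite (le_trans (ler_norm _)).
exists (- M) => _ [g [mg fg] ->].
rewrite -(Rintegral_prob_cst (- M)); apply: le_Rintegral => //.
- exact/integrable_measurable_bounded/measurable_bounded_cst.
- exact: integrable_measurable_bounded.
- by move=> x _; rewrite (le_trans _ (fg x))// lerNl (le_trans _ (fM x))// -normrN ler_norm.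
Qed.

Lemma upper_integral_le (f : bfun T R) g : measurable_bounded g ->
  (forall x, f x <= g x) -> upper_integral f <= \int[P]_(x in setT) g x.
Proof. by move=> mg fg; apply: ge_inf; [exact: (upper_has_inf f).2|exists g]. Qed.

Lemma upper_integral_sublinear : sublinear upper_integral.
Proof.
split=> [f g|c f c0].
  apply/ler_addgt0Pr => e e0.
  have e2 : 0 < e / 2 by lra.
  have [_ [f' [mf ff] ->] lf] := inf_adherent e2 (upper_has_inf f).
  have [_ [g' [mg gg] ->] lg] := inf_adherent e2 (upper_has_inf g).
  have mfg : measurable_bounded (fun x => f' x + g' x).
    split; first by apply: measurable_funD; [exact: mf.1|exact: mg.1].
    have [[M fM] [N gN]] := (mf.2, mg.2); exists (M + N) => x.
    by rewrite (le_trans (ler_normD _ _))// lerD.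
  have := upper_integral_le mfg (fun x => lerD (ff x) (gg x) : (f + g) x <= _).
  rewrite RintegralD//; [|exact: integrable_measurable_bounded..].
  by move: lf lg; rewrite -/(upper_integral f) -/(upper_integral g); lra.
apply/ler_addgt0Pr => e e0.
have e1 : 0 < e / (c + 1) by rewrite divr_gt0// ltr_wpDl.
have [_ [f' [mf ff] ->] lf] := inf_adherent e1 (upper_has_inf f).
have mcf : measurable_bounded (fun x => c * f' x).
  split; first by apply: measurable_funM; [exact: measurable_cst|exact: mf.1].
  by have [M fM] := mf.2; exists (c * M) => x; rewrite normrM ger0_norm// ler_wpM2l.
have := upper_integral_le mcf (fun x => ler_wpM2l c0 (ff x) : (c *: f) x <= _).
rewrite RintegralZl//; last exact: integrable_measurable_bounded.
move=> /le_trans; apply.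
rewrite (le_trans (ler_wpM2l c0 (ltW lf)))// -/(upper_integral f) mulrDr lerD2l.
by rewrite mulrCA ler_piMr ?ltW// ltr_pdivrMr ?ltr_wpDl// mul1r ltrDl.
Qed.

(* A finitely additive extension of [P] to all subsets of [T], seen as a
   positive functional on all bounded functions. *)
Lemma exists_mean : exists L : {scalar bfun T R}, forall (f : bfun T R) g,
  measurable_bounded g -> (forall x, f x <= g x) ->
  L f <= \int[P]_(x in setT) g x.
Proof.
have [L Lp] := sublinear_dominates_linear upper_integral_sublinear.
by exists L => f g mg fg; exact: le_trans (Lp f) (upper_integral_le mg fg).
Qed.

End Mean.

(** * Sums of nonnegative functions with known finite integral *)

Section NonnegativeIntegral.
Local Open Scope classical_set_scope.
Local Open Scope ring_scope.
Variables (d : measure_display) (T : measurableType d) (R : realType).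
Variable P : probability T R.

Definition has_ge0_integral (F : T -> R) (v : R) : Prop :=
  [/\ measurable_fun setT F, forall u, 0 <= F u
    & (\int[P]_u (F u)%:E = v%:E)%E].

Lemma has_ge0_integralD F G v w : has_ge0_integral F v ->
  has_ge0_integral G w -> has_ge0_integral (fun u => F u + G u) (v + w).
Proof.
move=> [mF F0 Fv] [mG G0 Gw]; split.
- exact: measurable_funD.
- by move=> u; rewrite addr_ge0.
- under eq_integral do rewrite EFinD.
  rewrite ge0_integralD//; first by rewrite Fv Gw.
  + by move=> u _; rewrite lee_fin.
  + exact/measurable_EFinP.
  + by move=> u _; rewrite lee_fin.
  + exact/measurable_EFinP.
Qed.

Lemma has_ge0_integral_sum I (s : seq I) (F : I -> T -> R) v :
  (forall i, has_ge0_integral (F i) (v i)) ->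
  has_ge0_integral (fun u => \sum_(i <- s) F i u) (\sum_(i <- s) v i).
Proof.
move=> Fv; elim: s => [|i s IH].
  under eq_fun do rewrite big_nil.
  rewrite big_nil; by split=> //; exact: integral0.
under eq_fun do rewrite big_cons.
by rewrite big_cons; exact: has_ge0_integralD.
Qed.

End NonnegativeIntegral.

(** * The mechanism driven by a uniform quantile, and its revenue *)

Section QuantileMechanism.
Variables (R : realType) (n : nat) (w : 'I_n -> {set 'I_n} -> R).
Variable H : 'I_n -> ('I_n -> R) -> R -> R.

(** If no report wins, the infimum takes the default value 0; this is harmless, since only winners
    pay. *)
Definition critical (u : R) (b : 'I_n -> R) (i : 'I_n) : R :=
  inf [set x : R | 0 <= x /\ u < H i b x]%classic.

Definition sold (u : R) (b : 'I_n -> R) : {set 'I_n} :=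
  [set i | u < H i b (b i)].

(* [H i b x] is the probability that [i] wins when it reports [x] and the
   others report [b]; drawing the quantile [u] uniformly realises it. *)
Definition quantile_mech (u : R) : mech R n :=
  fun b => (sold u b, fun i => critical u b i + w i (sold u b)).

Hypothesis H_upd : forall i b y x, H i (upd b i y) x = H i b x.
Hypothesis H_homo : forall i b, {homo H i b : x y / x <= y}.
Hypothesis H_max0 : forall i b x, H i b (Num.max 0 x) = H i b x.
Hypothesis w_ge0 : forall i S, 0 <= w i S.

Lemma critical_le u b i x : 0 <= x -> u < H i b x -> critical u b i <= x.
Proof. by move=> x0 ux; apply: ge_inf => //; exists 0 => y []. Qed.

Lemma le_critical u b i x y : 0 <= y -> u < H i b y -> H i b x <= u ->
  x <= critical u b i.
Proof.
move=> y0 uy xu; apply: lb_le_inf; first by exists y.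
move=> z [z0 uz]; rewrite leNgt; apply/negP => /ltW /(@H_homo i b) zx.
by have := lt_le_trans uz (le_trans zx xu); rewrite ltxx.
Qed.

Lemma critical_ge0 u b i : 0 <= critical u b i.
Proof.
rewrite /critical; set E := (X in inf X).
have [->|E0] := eqVneq E set0; first by rewrite inf0.
by apply: lb_le_inf => [|x []//]; exact/set0P.
Qed.

Lemma critical_upd u b i y : critical u (upd b i y) i = critical u b i.
Proof. by congr inf; apply/seteqP; split=> x /=; rewrite H_upd. Qed.

Lemma mem_sold_upd u b i y : (i \in sold u (upd b i y)) = (u < H i b y).
Proof. by rewrite inE H_upd /upd eqxx. Qed.

(** The surcharge [w i S] cancels the publicly known part of the value. What remains is a posted
    price that does not depend on the report of [i]. *)
Lemma quantile_mech_truthful u : truthful (val_add w) (quantile_mech u).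
Proof.
move=> b b0 i ti x ti0 x0.
have utilE y : utility (val_add w) (quantile_mech u) (upd b i y) i ti =
    if u < H i b y then ti - critical u b i else 0.
  rewrite /utility /winners /= mem_sold_upd critical_upd /val_add.
  by case: ifP => // _; rewrite opprD addrACA subrr addr0.
rewrite !utilE; case: (ltP u (H i b ti)) => uti.
  have ci : 0 <= ti - critical u b i by rewrite subr_ge0 critical_le.
  by split=> //; case: ifP.
by split=> //; case: ifP => // ux; rewrite subr_le0; exact: le_critical ux uti.
Qed.

Lemma measurable_winning (c : R) : measurable_fun [set: R]%classic (fun u : R => u < c).
Proof. by apply: measurable_fun_ltr => //; exact: measurable_cst. Qed.

Lemma measurable_charge i b x :
  measurable_fun [set: R]%classic
    (fun u => if u < H i b x then critical u b i else 0).
Proof.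
have H0 u : u < H i b x -> u < H i b (Num.max 0 x) by rewrite H_max0.
have m0 : 0 <= Num.max 0 x by rewrite le_max lexx.
(* Where [i] wins, the critical price increases with [u] and is at most [Num.max 0 x]; putting this
   bound elsewhere makes the inner function monotone on the whole line. The maximum with 0 covers
   negative reports, as measurability is required at every vector. *)
rewrite [X in measurable_fun _ X](_ : _ = fun u => if u < H i b x then
    (if u < H i b x then critical u b i else Num.max 0 x) else 0); last first.
  by apply/funext => u; case: ifP.
apply: measurable_fun_ifT; [exact: measurable_winning| |exact: measurable_cst].
apply: nondecreasing_measurable => // u v uv.
have [vx|_] := ltP v (H i b x).
  rewrite (le_lt_trans uv vx); apply: lb_le_inf.
    by exists (Num.max 0 x); split=> //; exact: H0.
  by move=> y [y0 vy]; rewrite critical_le// (le_lt_trans uv).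
by case: ifP => // ux; rewrite critical_le// H0.
Qed.

Lemma measurable_comp_finset (S : R -> {set 'I_n}) (g : {set 'I_n} -> R) :
  (forall i, measurable_fun [set: R]%classic (fun u => i \in S u)) ->
  measurable_fun [set: R]%classic (fun u => g (S u)).
Proof.
(* The product over agents is the indicator of [S u = A]. *)
move=> mS; rewrite [X in measurable_fun _ X](_ : _ = fun u => \sum_A g A *
    \prod_i (if i \in S u then (i \in A)%:R else (i \notin A)%:R)); last first.
  apply/funext => u; rewrite (bigD1 (S u))//= big1 ?mulr1 => [|i _]; last first.
    by case: ifP => ->.
  rewrite big1 ?addr0// => A /eqP AS; apply/eqP; rewrite mulf_eq0; apply/orP; right.
  have [i iAS] : exists i, (i \in S u) != (i \in A).
    apply: contrapT => h; apply: AS; apply/setP => i; apply/eqP.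
    by apply: contrapT => /negP iAS; apply: h; exists i; rewrite eq_sym.
  rewrite (bigD1 i)//= mulf_eq0; apply/orP; left.
  by move: iAS; case: (i \in S u); case: (i \in A).
apply: measurable_sum => A; apply: measurable_funM; first exact: measurable_cst.
apply: measurable_prod => i _.
by apply: measurable_fun_ifT => //; exact: measurable_cst.
Qed.

Lemma revenue_quantileE u b : revenue (quantile_mech u) b =
  \sum_i (if u < H i b (b i) then critical u b i else 0) +
  \sum_(i in sold u b) w i (sold u b).
Proof.
rewrite [X in _ + X]big_mkcond -big_split; apply: eq_bigr => i _ /=.
by rewrite /payment /winners /= !inE; case: ifP => _; rewrite ?addr0.
Qed.

Lemma measurable_revenue_quantile b :
  measurable_fun [set: R]%classic (fun u => revenue (quantile_mech u) b).
Proof.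
under eq_fun do rewrite revenue_quantileE.
apply: measurable_funD.
  by apply: measurable_sum => i; exact: measurable_charge.
apply: (@measurable_comp_finset (sold ^~ b) (fun S => \sum_(i in S) w i S)) => i.
under eq_fun do rewrite inE; exact: measurable_winning.
Qed.

(** The intervals between successive values of [H] are disjoint, so at most one term is nonzero. If
    it is the [k]-th, report [y k] loses, and the critical price is at least [y k]. *)
Lemma staircase_le_charge (y : nat -> R) u b i N :
  (forall k, 0 <= y k) -> {homo y : k l / (k <= l)%N >-> k <= l} ->
  \sum_(k < N) y k * (H i b (y k) <= u < H i b (y k.+1))%R%:R <=
  if u < H i b (y N) then critical u b i else 0.
Proof.
move=> y0 yh; elim: N => [|N IH].
  by rewrite big_ord0; case: ifP => // _; exact: critical_ge0.
rewrite big_ord_recr /=; case: (ltP u (H i b (y N))) IH => uN IH.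
  by rewrite /= mulr0 addr0 (lt_le_trans uN (H_homo i b (yh _ _ (leqnSn N)))).
rewrite -[leRHS]add0r lerD//; case: ifP => uS /=; rewrite ?mulr0 ?mulr1//.
exact: le_critical uS uN.
Qed.

Let U := uniform_prob (@ltr01 R).

Lemma uniform_prob01_itv (c e : R) : 0 <= c -> c <= e -> e <= 1 ->
  U `[c, e[%classic = (e - c)%:E.
Proof.
move=> c0 ce e1; rewrite /U /uniform_prob integral_uniform_pdf.
rewrite setIidl; last first.
  move=> x /=; rewrite !in_itv /= => /andP[cx xe].
  by rewrite (le_trans c0 cx) (le_trans (ltW xe) e1).
rewrite (eq_integral (fun=> 1%:E)); last first.
  move=> x; rewrite inE/= in_itv/= => /andP[cx xe].
  by rewrite /uniform_pdf (le_trans c0 cx) (le_trans (ltW xe) e1) subr0 invr1.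
rewrite integral_cst//= mul1e lebesgue_measure_itv /= lte_fin.
by case: ltgtP ce => // -> _; rewrite subrr.
Qed.

Lemma has_ge0_integral_step (a c e : R) : 0 <= a -> 0 <= c -> c <= e -> e <= 1 ->
  has_ge0_integral U (fun u => a * (c <= u < e)%R%:R) (a * (e - c)).
Proof.
move=> a0 c0 ce e1.
have mI : measurable `[c, e[%classic by exact: measurable_itv.
have E u : (c <= u < e)%R%:R = \1_(`[c, e[%classic) u :> R.
  by rewrite indicE mem_setE in_itv.
split.
- apply: measurable_funM; first exact: measurable_cst.
  under eq_fun do rewrite E; exact: measurable_indic.
- by move=> u; rewrite mulr_ge0.
- under eq_integral do rewrite E EFinM.
  rewrite ge0_integralZl//.
  + rewrite integral_indic//= setIT EFinM; congr (_ * _)%E.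
    exact: uniform_prob01_itv.
  + exact/measurable_EFinP/measurable_indic.
Qed.

(** The left side integrates a step function lying below the revenue: the staircases bound the
    critical prices, and for [u] in [[0, a[] everybody wins and pays the full surcharge. *)
Lemma exp_revenue_quantile_ge (a : R) t (y : 'I_n -> nat -> R) N :
  (forall i x, H i t x <= 1) -> 0 <= a -> a <= 1 -> (forall i x, a <= H i t x) ->
  (forall i k, 0 <= y i k) ->
  (forall i, {homo y i : k l / (k <= l)%N >-> k <= l}) ->
  (forall i, y i N = t i) ->
  ((\sum_i \sum_(k < N) y i k * (H i t (y i k.+1) - H i t (y i k)) +
    a * \sum_i w i [set: 'I_n])%:E <= exp_revenue U quantile_mech t)%E.
Proof.
move=> H1 a0 a1 aH y0 yh yN.
pose W := \sum_i w i [set: 'I_n].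
have W0 : 0 <= W by exact: sumr_ge0.
have [mF F0 Fv] := has_ge0_integralD
  (has_ge0_integral_sum (index_enum 'I_n) (fun i =>
    has_ge0_integral_sum (index_enum 'I_N) (fun k : 'I_N =>
    has_ge0_integral_step (y0 i k) (le_trans a0 (aH i (y i k)))
     (H_homo i t (yh i _ _ (leqnSn k))) (H1 i (y i k.+1)))))
  (has_ge0_integral_step W0 (lexx 0) a0 a1).
rewrite /exp_revenue mulrC -/W -[X in (_ + W * X)%:E]subr0 -Fv.
apply: ge0_le_integral => //.
- by move=> u _; rewrite lee_fin.
- exact/measurable_EFinP.
- by apply/measurable_EFinP; exact: measurable_revenue_quantile.
move=> u _; rewrite lee_fin revenue_quantileE lerD//.
  by apply: ler_sum => i _; rewrite -(yN i); exact: staircase_le_charge.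
have [/andP[_ ua]|_] := boolP (0 <= u < a); last by rewrite mulr0 sumr_ge0.
have -> : sold u t = [set: 'I_n].
  by apply/setP => i; rewrite !inE (lt_le_trans ua).
by rewrite mulr1 [leRHS](eq_bigl predT)// => i; rewrite inE.
Qed.

End QuantileMechanism.

(** * Threshold structure of truthful digital goods mechanisms *)

Section DigitalGoods.
Variables (R : realType) (n : nat) (m : mech R n) (b : 'I_n -> R) (i : 'I_n).
Hypothesis m_truthful : truthful (@val_dg R n) m.
Hypothesis b_ge0 : forall j, 0 <= b j.

Let wins x := i \in winners m (upd b i x).
Let price x := (m (upd b i x)).2 i.

Lemma dg_price_le x : 0 <= x -> wins x -> price x <= x.
Proof.
move=> x0 wx; have [_] := m_truthful b_ge0 i x0 x0.
by rewrite /utility -/(wins x) wx /val_dg subr_ge0.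
Qed.

Lemma dg_price_le_price x y : 0 <= x -> 0 <= y -> wins x -> wins y -> price x <= price y.
Proof.
move=> x0 y0 wx wy; have [+ _] := m_truthful b_ge0 i x0 y0.
by rewrite /utility -/(wins x) -/(wins y) wx wy /val_dg lerD2l lerN2.
Qed.

Lemma dg_wins_homo x y : 0 <= x -> x <= y -> wins x -> wins y.
Proof.
move=> x0; rewrite le_eqVlt => /predU1P[->//|xy] wx.
have y0 := le_trans x0 (ltW xy).
have [+ _] := m_truthful b_ge0 i y0 x0.
rewrite /utility -/(wins x) -/(wins y) wx /val_dg; case: (wins y) => //.
have := dg_price_le x0 wx; rewrite /price; lra.
Qed.

Lemma dg_payment_le x : 0 <= x -> payment m (upd b i x) i <= x.
Proof. by move=> x0; rewrite /payment; case: ifP => // wx; exact: dg_price_le. Qed.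

(** Winning is monotone in the report, so the sum is the last losing grid point, or 0 if there is
    none. A winner pays at most the first winning grid point, which is within [e] of it. *)
Lemma dg_payment_staircase (y : nat -> R) (e : R) N :
  (forall k, 0 <= y k) -> {homo y : k l / (k <= l)%N >-> k <= l} ->
  y 0%N = 0 -> (forall k, y k.+1 <= y k + e) -> 0 <= e ->
  Num.max (payment m (upd b i (y N)) i) 0 - e <=
  \sum_(k < N) y k * ((wins (y k.+1))%:R - (wins (y k))%:R).
Proof.
move=> y0 yh y00 ye e0.
have incr k : (wins (y k))%:R <= (wins (y k.+1))%:R :> R.
  rewrite ler_nat; case wk: (wins (y k)) => //.
  by rewrite (dg_wins_homo (y0 k) (yh _ _ (leqnSn k)) wk).
have sum0 M : 0 <= \sum_(k < M) y k * ((wins (y k.+1))%:R - (wins (y k))%:R).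
  by apply: sumr_ge0 => k _; rewrite mulr_ge0// subr_ge0.
rewrite lerBlDr ge_max; apply/andP; split; last by rewrite addr_ge0.
elim: N => [|N IH].
  (* The grid must start at 0, where a winner pays at most 0. *)
  by rewrite big_ord0 add0r y00 (le_trans (dg_payment_le (lexx 0))).
rewrite big_ord_recr /=; move: IH; rewrite /payment -/(wins _) -/(wins _).
case wN: (wins (y N)); case wS: (wins (y N.+1)) => IH; rewrite ?subrr ?mulr0 ?addr0 ?subr0 ?mulr1.
- by apply: le_trans IH; exact: dg_price_le_price.
- by have := dg_wins_homo (y0 N) (yh _ _ (leqnSn N)) wN; rewrite wS.
- have := dg_price_le (y0 N.+1) wS; rewrite /price.
  by have := sum0 N; have := ye N; lra.
- exact: IH.
Qed.

End DigitalGoods.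

(** * Comparing the two benchmarks *)

Section Benchmark.
Variables (R : realType) (n : nat) (t : 'I_n -> R).
Hypotheses (hn : (2 <= n)%N) (t_ge0 : forall i, 0 <= t i).

Lemma F2_dg_ge (c : R) (S : {set 'I_n}) : 0 <= c -> (1 < #|S|)%N ->
  (forall i, i \in S -> c <= t i) -> c * #|S|%:R <= F2 (@val_dg R n) t.
Proof.
move=> c0 S1 cS; apply: ub_le_sup; last by exists c, S.
exists (\sum_i t i) => _ [e [Q [e0 _ eQ ->]]].
rewrite mulr_natr -sumr_const big_mkcond /=; apply: ler_sum => i _.
by case: ifP => // /eQ.
Qed.

Lemma F2_dg_ge0 : 0 <= F2 (@val_dg R n) t.
Proof.
have := @F2_dg_ge 0 [set: 'I_n] (lexx 0); rewrite mul0r; apply => //.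
by rewrite cardsT card_ord.
Qed.

Lemma F2_add_le (w : 'I_n -> {set 'I_n} -> R) :
  (forall i S, 0 <= w i S) ->
  (forall i (S : {set 'I_n}), i \in S -> w i S <= w i [set: 'I_n]) ->
  F2 (val_add w) t <= 2 * (F2 (@val_dg R n) t + \sum_i w i [set: 'I_n]).
Proof.
move=> w0 wT; apply: ge_sup.
  exists (0 * #|[set: 'I_n]|%:R), 0, [set: 'I_n]; split=> //.
    by rewrite cardsT card_ord.
  by move=> i _; rewrite addr_ge0.
move=> _ [c [S [c0 S1 cS ->]]].
set W := \sum_i _.
have cw i : i \in S -> c - t i <= w i [set: 'I_n].
  by move=> iS; have := cS i iS; have := wT i S iS; rewrite /val_add; lra.
have W_ge (B : {set 'I_n}) : \sum_(i in B) w i [set: 'I_n] <= W.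
  by rewrite big_mkcond; apply: ler_sum => i _; case: ifP.
pose A := [set i in S | c / 2 <= t i].
have AS : A \subset S by apply/fintype.subsetP => i; rewrite inE => /andP[].
have low i : i \in S :\: A -> c / 2 <= w i [set: 'I_n].
  rewrite !inE negb_and => /andP[+ iS]; rewrite iS /= -ltNge => ti.
  by have := cw i iS; lra.
have low_sum (B : {set 'I_n}) : B \subset S :\: A ->
    c / 2 * #|B|%:R <= \sum_(i in B) w i [set: 'I_n].
  move=> /fintype.subsetP BS; rewrite mulr_natr -sumr_const.
  by apply: ler_sum => i /BS; exact: low.
have cardS : #|S|%:R = #|A|%:R + #|S :\: A|%:R :> R.
  by rewrite -natrD -(cardsID A S) (finset.setIidPr AS).
have F0 := F2_dg_ge0.
have [A1|] := ltnP 1 #|A|.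
  have FA : c / 2 * #|A|%:R <= F2 (@val_dg R n) t.
    by apply: F2_dg_ge => // [|i]; [lra|rewrite inE => /andP[]].
  have := le_trans (low_sum _ (fintype.subxx _)) (W_ge _); rewrite cardS; lra.
rewrite leq_eqVlt ltnS leqn0 cards_eq0 => /orP[/cards1P[a Aa]|/eqP A0]; last first.
  have := le_trans (low_sum _ (fintype.subxx _)) (W_ge _).
  by rewrite A0 finset.setD0; lra.
have aA : a \in A by rewrite Aa inE.
have : (0 < #|S :\: A|)%N by rewrite cardsDS// Aa cards1 subn_gt0.
case/card_gt0P => j jSA; have := jSA.
rewrite finset.in_setD => /andP[jA jS].
have tj : t j < c / 2 by move: jA; rewrite inE jS /= -ltNge.
have ja : j != a by apply: contraNneq jA => ->.
(* The single agent [a] of [A] is no admissible set by itself. Selling to [a] and [j] at price [t j]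
   earns [2 * t j]; with [w j >= c - t j] this covers the share [c] of the pair. *)
have Fj : t j * 2 <= F2 (@val_dg R n) t.
  have c2 : #|[set j; a]| = 2%N by rewrite cards2 ja.
  have := @F2_dg_ge (t j) [set j; a] (t_ge0 j); rewrite c2; apply=> // i.
  rewrite !inE => /orP[]/eqP->//.
  by move: aA; rewrite inE => /andP[_]; lra.
have := W_ge (S :\: A); rewrite (big_setD1 j)//= => Wj.
have := low_sum ((S :\: A) :\ j) (finset.subD1set _ _).
have := cw j jS; have := t_ge0 j.
have : #|S|%:R = 2 + #|(S :\: A) :\ j|%:R :> R.
  by rewrite cardS (cardsD1 j (S :\: A)) jSA Aa cards1 natrD addrA.
move: Wj; set s := \sum_(i in _) _; set k := #|_ :\ _|%:R.
by move=> Wj -> *; lra.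
Qed.

End Benchmark.

(** * Winning probabilities under the extended expectation *)

Section WinningMass.
Variables (R : realType) (n : nat).
Variables (d : measure_display) (T : measurableType d) (P : probability T R).
Variables (M : T -> mech R n).
Hypothesis M_univ : univ_truthful P (@val_dg R n) M.
Variable L : {scalar bfun T R}.
Hypothesis L_le : forall (f : bfun T R) g, measurable_bounded g ->
  (forall x, f x <= g x) -> L f <= \int[P]_(x in [set: T]%classic) g x.

Lemma mean_le_cst (f : bfun T R) (c : R) : (forall x, f x <= c) -> L f <= c.
Proof.
move=> fc; rewrite -(Rintegral_prob_cst P c).
by apply: L_le => //; exact: measurable_bounded_cst.
Qed.

Lemma mean_homo (f g : bfun T R) : (forall x, f x <= g x) -> L f <= L g.
Proof.
move=> fg; rewrite -subr_le0 -linearB; apply: mean_le_cst => x.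
by rewrite bfunDE bfunNE subr_le0.
Qed.

(** Truthfulness constrains nonnegative reports only; clipping makes the winning mass monotone on
    all reals. *)
Definition clip (b : 'I_n -> R) : 'I_n -> R := fun j => Num.max 0 (b j).

Lemma clip_ge0 b j : 0 <= clip b j.
Proof. by rewrite /clip le_max lexx. Qed.

Definition win_event i b x : bfun T R :=
  bool_bfun R (fun s => i \in winners (M s) (upd (clip b) i (Num.max 0 x))).

Definition win_mass i b x : R := L (win_event i b x).

Lemma win_mass_upd i b y x : win_mass i (upd b i y) x = win_mass i b x.
Proof.
rewrite /win_mass /win_event; congr (L (bool_bfun _ _)).
apply/funext => s; congr (_ \in winners _ _); apply/funext => j.
by rewrite /upd /clip; case: eqP.
Qed.

Lemma win_mass_max0 i b x : win_mass i b (Num.max 0 x) = win_mass i b x.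
Proof. by rewrite /win_mass /win_event maxA maxxx. Qed.

Lemma win_mass_ge0 i b x : 0 <= win_mass i b x.
Proof.
rewrite -oppr_le0 -linearN; apply: mean_le_cst => s.
by rewrite bfunNE oppr_le0 /=.
Qed.

Lemma win_mass_le1 i b x : win_mass i b x <= 1.
Proof. by apply: mean_le_cst => s /=; rewrite lern1 leq_b1. Qed.

Lemma win_mass_homo i b : {homo win_mass i b : x y / x <= y}.
Proof.
move=> x y xy; apply: mean_homo => s /=.
rewrite ler_nat; case wx: (_ \in _) => //=.
rewrite lt0b (dg_wins_homo (M_univ.1 s) (clip_ge0 b) _ _ wx)//.
  by rewrite le_max lexx.
by rewrite ge_max le_max lexx le_max xy orbT.
Qed.

(** Pointwise, the revenue exceeds a combination [h] of winning events by at most [e *+ n]. Applying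
    [L] keeps this inequality although [h] need not be measurable. *)
Lemma exp_revenue_le_win_mass t (y : 'I_n -> nat -> R) (e : R) N :
  (forall i, 0 <= t i) ->
  (forall i k, 0 <= y i k) ->
  (forall i, {homo y i : k l / (k <= l)%N >-> k <= l}) ->
  (forall i, y i 0%N = 0) -> (forall i, y i N = t i) ->
  (forall i k, y i k.+1 <= y i k + e) -> 0 <= e ->
  (exp_revenue P M t <= (\sum_i \sum_(k < N)
    y i k * (win_mass i t (y i k.+1) - win_mass i t (y i k)) + e *+ n)%:E)%E.
Proof.
move=> t0 y0 yh y00 yN ye e0.
(* Prices may be negative without bound, whereas the positive part of the revenue is at most the sum
   of the types, hence integrable. *)
pose r s := Num.max (revenue (M s) t) 0.
pose h : bfun T R := \sum_i \sum_(k < N)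
  y i k *: (win_event i t (y i k.+1) - win_event i t (y i k)).
have Lh : L h = \sum_i \sum_(k < N)
    y i k * (win_mass i t (y i k.+1) - win_mass i t (y i k)).
  rewrite /h linear_sum; apply: eq_bigr => i _.
  by rewrite linear_sum; apply: eq_bigr => k _; rewrite linearZ linearB.
have clipt : clip t = t by apply/funext => j; rewrite /clip max_r.
have updt i x : t i = x -> upd t i x = t.
  by move=> <-; apply/funext => j; rewrite /upd; case: eqP => // ->.
have rh s : r s - e *+ n <= h s.
  rewrite /h bfun_sumE -[X in e *+ X]card_ord -sumr_const.
  apply: (@le_trans _ _ (\sum_i (Num.max (payment (M s) t i) 0 - e))).
    rewrite sumrB lerD2r /r ge_max; apply/andP; split.
      by apply: ler_sum => i _; rewrite le_max lexx.
    by apply: sumr_ge0 => i _; rewrite le_max lexx orbT.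
  apply: ler_sum => i _; rewrite bfun_sumE.
  have := @dg_payment_staircase R n (M s) t i (M_univ.1 s) t0 _ _ N (y0 i) (yh i) (y00 i) (ye i) e0.
  rewrite (updt i (y i N))// => /le_trans; apply.
  apply: ler_sum => k _; rewrite bfunZE bfunDE bfunNE /= clipt.
  by rewrite !max_r.
have rM s : `|r s| <= \sum_i t i.
  have st0 : 0 <= \sum_i t i by exact: sumr_ge0.
  rewrite ger0_norm /r ?le_max ?lexx ?orbT// ge_max st0 andbT.
  apply: ler_sum => i _; have := @dg_payment_le R n (M s) t i (M_univ.1 s) t0 _ (t0 i).
  by rewrite (updt i (t i)).
have mr : measurable_bounded r.
  split; last by exists (\sum_i t i).
  by apply: measurable_maxr; [exact: M_univ.2|exact: measurable_cst].
have mer : measurable_bounded (fun s => e *+ n - r s).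
  split.
    by apply: measurable_funB; [exact: measurable_cst|exact: mr.1].
  exists (e *+ n + \sum_i t i) => s.
  by rewrite (le_trans (ler_normB _ _))// lerD// ger0_norm// mulrn_wge0.
have ir := integrable_measurable_bounded P mr.
(* Domination is used at [- h], whose majorant [e *+ n - r] is measurable; this bounds [L h] from
   below. *)
have := @L_le (- h) _ mer; rewrite linearN Lh RintegralB//; last first.
  exact/integrable_measurable_bounded/measurable_bounded_cst.
rewrite Rintegral_prob_cst => Lle.
apply: (@le_trans _ _ (\int[P]_s (r s)%:E)%E); last first.
  rewrite -(fineK (integrable_fin_num _ ir))// lee_fin -/(Rintegral P setT r).
  suff /Lle : forall s, (- h) s <= e *+ n - r s by lra.
  by move=> s; rewrite bfunNE; have := rh s; lra.
(* Dropping the integral of the negative part, possibly infinite, only increases the expectation. *)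
rewrite /exp_revenue integralE.
rewrite [X in (_ <= X)%E](_ : _ = \int[P]_s (EFin \o (fun s => revenue (M s) t))^\+ s)%E; last first.
  by apply: eq_integral => s _; rewrite funeposE /= EFin_max.
by rewrite -[leRHS]sube0 leeB// integral_ge0.
Qed.

End WinningMass.

(** * Choice of the mixing weights and of the grid *)

Theorem theorem4 (R : realType) (n : nat) (hn : (2 <= n)%N) (alpha : R)
  (halpha : 1 <= alpha)
  (d0 : measure_display) (T0 : measurableType d0) (P0 : probability T0 R)
  (M0 : T0 -> mech R n)
  (hM0 : univ_truthful P0 (@val_dg R n) M0)
  (hcomp0 : alpha_competitive P0 (@val_dg R n) M0 alpha)
  (w : 'I_n -> {set 'I_n} -> R)
  (hw0 : forall i S, 0 <= w i S)
  (hmono : forall i ti, 0 <= ti -> forall S Q : {set 'I_n}, S \subset Q ->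
     vfull (val_add w) i ti S <= vfull (val_add w) i ti Q)
  (hsub : forall i ti, 0 <= ti -> forall S Q : {set 'I_n},
     i \in S -> i \in Q ->
     vfull (val_add w) i ti (S :|: Q)
       <= vfull (val_add w) i ti S + vfull (val_add w) i ti Q) :
  exists (d : measure_display) (T : measurableType d) (P : probability T R)
         (M : T -> mech R n),
    univ_truthful P (val_add w) M /\
    alpha_competitive P (val_add w) M (2 * (1 + alpha)).
Proof.
have [L L_le] := exists_mean P0.
pose G := win_mass M0 L.
have a_gt0 : 0 < 1 + alpha by lra.
(* The weights [a] and [q = a * alpha] satisfy [q / alpha = a], so the guarantee of [M0] and the
   surcharges enter with equal coefficients. *)
pose a := (1 + alpha)^-1.
have a0 : 0 < a by rewrite invr_gt0.
have aa : a * (1 + alpha) = 1 by rewrite mulVf ?gt_eqF.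
pose q := a * alpha.
have q0 : 0 <= q by rewrite mulr_ge0 ?ltW//; lra.
have aq : a + q = 1 by rewrite /q -[X in X + _]mulr1 -mulrDr.
pose H i b x := a + q * G i b x.
have H_upd i b y x : H i (upd b i y) x = H i b x by rewrite /H /G win_mass_upd.
have H_max0 i b x : H i b (Num.max 0 x) = H i b x by rewrite /H /G win_mass_max0.
have H_homo i b : {homo H i b : x y / x <= y}.
  by move=> x y xy; rewrite lerD2l ler_wpM2l//; exact: (win_mass_homo hM0 L_le).
have H_ge i b x : a <= H i b x.
  by rewrite lerDl mulr_ge0//; exact: (win_mass_ge0 _ L_le).
have H_le1 i b x : H i b x <= 1.
  by rewrite -aq lerD2l ler_piMr//; exact: (win_mass_le1 _ L_le).
exists _, _, (uniform_prob (@ltr01 R)), (quantile_mech w H); split.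
  split=> [u|t]; first exact: quantile_mech_truthful.
  exact: measurable_revenue_quantile.
move=> t t0; apply/lee_subgt0Pr => e e0.
pose s := \sum_j t j.
have s0 : 0 <= s by exact: sumr_ge0.
(* With mesh [s / N], valid for every agent as [t i <= s], the [n] grid errors add up to at most
   [e]; the successor keeps [N] positive. *)
pose N := (Num.bound (s *+ n / e)).+1.
have N0 : 0 < N%:R :> R by rewrite ltr0n.
pose y i k := k%:R * (t i / N%:R).
have y0 i k : 0 <= y i k by rewrite mulr_ge0// divr_ge0// ltW.
have yh i : {homo y i : k l / (k <= l)%N >-> k <= l}.
  by move=> k l kl; rewrite ler_wpM2r ?ler_nat// divr_ge0// ltW.
have y00 i : y i 0%N = 0 by rewrite /y mul0r.
have yN i : y i N = t i by rewrite /y mulrC divfK// gt_eqF.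
have ye i k : y i k.+1 <= y i k + s / N%:R.
  rewrite /y -natr1 mulrDl mul1r lerD2l ler_pM2r ?invr_gt0//.
  by rewrite /s (bigD1 i)//= lerDl sumr_ge0.
have sN0 : 0 <= s / N%:R by rewrite divr_ge0// ltW.
have sNe : (s / N%:R) *+ n <= e.
  rewrite -mulrnAl ler_pdivrMr// mulrC -ler_pdivrMr//.
  apply: ltW; apply: lt_le_trans (archi_boundP _) _.
    by rewrite divr_ge0 ?mulrn_wge0// ltW.
  by rewrite ler_nat.
have upper := exp_revenue_le_win_mass hM0 L_le t0 y0 yh y00 yN ye sN0.
have a1 : a <= 1 by lra.
have := exp_revenue_quantile_ge H_homo H_max0 hw0 (H_le1^~ t) (ltW a0) a1 (H_ge^~ t) y0 yh yN.
apply: le_trans; rewrite -EFinB lee_fin.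
have := le_trans (hcomp0 t t0) upper; rewrite lee_fin -/G.
set X := \sum_i _ => FX.
have -> : \sum_i \sum_(k < N) y i k * (H i t (y i k.+1) - H i t (y i k)) = q * X.
  rewrite /X mulr_sumr; apply: eq_bigr => i _; rewrite mulr_sumr.
  by apply: eq_bigr => k _; rewrite /H opprD addrACA subrr add0r -mulrBr mulrCA.
have F2le : F2 (val_add w) t <= 2 * (F2 (@val_dg R n) t + \sum_i w i [set: 'I_n]).
  apply: F2_add_le => // i S iS.
  (* At type 0 the value is the surcharge alone, so its monotonicity follows. *)
  have := hmono i 0 (lexx 0) S [set: 'I_n] (finset.subsetT S).
  by rewrite /vfull iS inE /val_add !add0r.
have FX' : a * F2 (@val_dg R n) t <= q * X + q * e.
  have -> : a * F2 (@val_dg R n) t = q * (F2 (@val_dg R n) t / alpha).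
    by rewrite /q -mulrA [alpha * _]mulrC divfK// gt_eqF //; lra.
  by rewrite -mulrDr ler_wpM2l//; lra.
have qe : q * e <= e by rewrite ler_piMl ?ltW//; lra.
have -> : F2 (val_add w) t / (2 * (1 + alpha)) = a * (F2 (val_add w) t / 2).
  by rewrite invfM mulrA mulrC.
have aF : a * (F2 (val_add w) t / 2) <=
    a * (F2 (@val_dg R n) t + \sum_i w i [set: 'I_n]).
  by apply: ler_wpM2l; [exact: ltW|lra].
by move: aF; rewrite mulrDr; lra.
Qed.
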